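(* The function $\hat\mu:\mathcal{T}\to\mathbb{R}$ is lower semicontinuous for the weak topology and continuous for the strong topology.
   Context: We work over $\mathbb{C}$; $F=\mathbb{C}(x,y)$ is the function field of $\mathbb{P}^2\supset\mathbb{A}^2=\operatorname{Spec}\mathbb{C}[x,y]$, and $p_1$ is the origin. $\mathcal{T}$ is the set of all real (rank 1) valuations of $F$ with center at $p_1$, up to normalization (normalized so that $\min\{v(x),v(y)\}=1$). For $v\in\mathcal{T}$, $\hat\mu(v)=\lim_{d\to\infty}\frac1d\max\{v(f)\mid 0\neq f\in\mathbb{C}[x,y],\ \deg f\le d\}$. All elements of $\mathcal{T}$ are obtained (after possibly exchanging the roles of $x$ and $y$) as valuations $v(\xi,t)$, $f\mapsto \operatorname{ord}_x f(x,\xi(x)+\theta x^t)$ with $\theta$ transcendental over $\mathbb{C}$, where $\xi(x)=\sum_{j\ge1}a_jx^{\beta_j}$ is a formal series whose exponents form an arbitrary increasing sequence of rational numbers and $t\in[1,\infty]$, with $t=\infty$ allowed except when $\xi$ is the (convergent) Puiseux series of a branch of curve through $p_1$. The weak topology on $\mathcal{T}$ is the coarsest one such that for all $f\in F$, $f\ne0$, the map $v\mapsto v(f)$ is continuous $\mathcal{T}\to\mathbb{R}$. The strong topology is the finest topology such that $t\mapsto v(\xi,t)$ is continuous for all such series $\xi$.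
   Formalization: The function μ̂ is taken with values in the extended reals instead of ℝ, since μ̂(v(ξ,∞)) = +∞ for ξ a transcendental power series; semicontinuity and continuity are proved at all points of T, including those. *)

(* Defs.v *)
From HB Require Import structures.
From mathcomp Require Import all_boot all_order all_algebra finmap.
From mathcomp Require Import polyXY fraction complex.
From mathcomp Require Import all_classical all_reals all_analysis.
From mathcomp Require Import ring lra.

Set Implicit Arguments.
Unset Strict Implicit.
Unset Printing Implicit Defensive.

Import Order.TTheory GRing.Theory Num.Theory.
Import numFieldNormedType.Exports.

Local Open Scope classical_set_scope.
Local Open Scope ring_scope.

Section WellOrdered.
Variable R : realType.
Implicit Types A B : set R.

Definition well_ordered A :=
  forall B, B `<=` A -> B !=set0 -> exists2 m, B m & forall b, B b -> m <= b.

Definition sumset A B : set R := [set c | exists2 a, A a & B (c - a)].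

Lemma well_ordered_sub A B : A `<=` B -> well_ordered B -> well_ordered A.
Proof. by move=> AB wB C CA; apply: wB; exact: subset_trans AB. Qed.

Lemma well_orderedU A B :
  well_ordered A -> well_ordered B -> well_ordered (A `|` B).
Proof.
move=> wA wB C CAB [c Cc].
have [CA0|CA0] := pselect (C `&` A !=set0); last first.
  apply: wB; last by exists c.
  by move=> x Cx; case: (CAB _ Cx) => // Ax; case: CA0; exists x.
have [CB0|CB0] := pselect (C `&` B !=set0); last first.
  apply: wA; last by exists c.
  by move=> x Cx; case: (CAB _ Cx) => // Ax; case: CB0; exists x.
have [a [Ca _] amin] := wA _ (@subIsetr _ C A) CA0.
have [b [Cb _] bmin] := wB _ (@subIsetr _ C B) CB0.
have [ab|ba] := leP a b.
  exists a => // x Cx; case: (CAB _ Cx) => ?; first exact: amin.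
  by apply: le_trans ab _; exact: bmin.
exists b => // x Cx; case: (CAB _ Cx) => ?; last exact: bmin.
by apply: le_trans (ltW ba) _; exact: amin.
Qed.

Lemma well_ordered0 : well_ordered set0.
Proof. by move=> B B0 [b /B0]. Qed.

Lemma well_ordered1 x : well_ordered [set x].
Proof.
move=> B Bx [b Bb]; exists b => // c Bc.
by rewrite (Bx _ Bb) (Bx _ Bc).
Qed.

Lemma well_ordered_sumset A B :
  well_ordered A -> well_ordered B -> well_ordered (sumset A B).
Proof.
move=> wA wB C CAB [c0 Cc0].
have [//|nomin] := pselect (exists2 m, C m & forall b, C b -> m <= b).
have lower c : C c -> exists2 d, C d & d < c.
  move=> Cc; apply: contrapT => H; apply: nomin; exists c => // b Cb.
  by rewrite leNgt; apply/negP => bc; apply: H; exists b.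
pose P (p : R * R) := [/\ A p.1, B p.2 & C (p.1 + p.2)].
have PC c : C c -> exists2 p, P p & p.1 + p.2 = c.
  by move=> Cc; have [a Aa Bca] := CAB _ Cc; exists (a, c - a); rewrite /P/= subrKC.
(* good pairs: every pair of smaller sum has a smaller first component *)
pose good p := P p /\ forall q, P q -> q.1 + q.2 < p.1 + p.2 -> q.1 < p.1.
have below c : C c -> exists2 p, good p & p.1 + p.2 < c.
  move=> Cc; have [d Cd dc] := lower _ Cc.
  pose Bs := [set b | exists2 a, P (a, b) & a + b < c].
  have [] := wB Bs.
  - by move=> b [a []].
  - by have [[a b] Pab /= ab] := PC _ Cd; exists b, a; rewrite // ab.
  move=> b [a Pab abc] bmin; exists (a, b) => //=; split=> // -[a' b'] Pq /= lt.
  have : b <= b' by apply: bmin; exists a' => //; exact: lt_trans abc.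
  lra.
have [] := wA [set a | exists b, good (a, b)].
- by move=> a [b [[]]].
- by have [[a b] g _] := below _ Cc0; exists a, b.
move=> a [b [Pab gab]] amin.
have [[a' b'] g' lt] := below _ (let: And3 _ _ h := Pab in h).
have := gab _ g'.1 lt => /=.
by rewrite ltNge (amin a') //; exists b'.
Qed.

Lemma finite_sumset_fiber A B s :
  well_ordered A -> well_ordered B -> finite_set [set a | A a /\ B (s - a)].
Proof.
move=> wA wB; set X := (X in finite_set X).
have Xmin Y : Y `<=` X -> Y !=set0 -> exists2 m, Y m & forall b, Y b -> m <= b.
  by move=> YX; apply: wA => x /YX[].
have Xmax Y : Y `<=` X -> Y !=set0 -> exists2 m, Y m & forall b, Y b -> b <= m.
  move=> YX [y Yy].
  have [||m Ym mmin] := wB [set s - x | x in Y].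
  - by move=> _ [x /YX[_ Bx] <-].
  - by exists (s - y), y.
  case: Ym mmin => x Yx <- mmin; exists x => // b Yb.
  have := mmin (s - b); have : [set s - x | x in Y] (s - b) by exists b.
  move=> h /(_ h); lra.
apply: contrapT => infX.
have X0 : X !=set0.
  by apply: contrapT => /nonemptyPn X0; apply: infX; rewrite X0.
pose down x := [set y | X y /\ y <= x].
pose Y := [set x | X x /\ infinite_set (down x)].
have [M XM Mmax] := Xmax _ (@subset_refl _ X) X0.
have [||m [Xm infm] mmin] := Xmin Y.
- by move=> x [].
- exists M; split=> //; rewrite (_ : down M = X)//.
  by apply/seteqP; split=> [x []//|x Xx]; split=> //; exact: Mmax.
pose D := [set y | X y /\ y < m].
have downm : down m `<=` D `|` [set m].
  move=> y [Xy]; rewrite le_eqVlt => /orP[/eqP ->|ym]; first by right.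
  by left.
have infD : infinite_set D.
  move=> finD; apply: infm; apply: sub_finite_set downm _.
  by rewrite finite_setU; split=> //; exact: finite_set1.
have [||p [Xp pm] pmax] := Xmax D.
- by move=> x [].
- by apply: contrapT => /nonemptyPn D0; apply: infD; rewrite D0.
have : Y p.
  split=> // fin; apply: infD; apply: sub_finite_set fin => y Dy.
  by split; [case: Dy|exact: pmax].
by move=> /mmin; rewrite leNgt pm.
Qed.

End WellOrdered.

Section HahnSeries.
Variables (R : realType) (K : comNzRingType).

(* Formal series \sum_s h_s x^s with coefficients in K, real exponents and
   well-ordered support. *)
Record hahn := Hahn {
  hcoef :> R -> K ;
  hsupp_wo : well_ordered [set s | hcoef s != 0] }.
Arguments hsupp_wo h : clear implicits.

HB.instance Definition _ := gen_eqMixin hahn.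
HB.instance Definition _ := gen_choiceMixin hahn.

Implicit Types f g h : hahn.

Lemma hahnP f g : (forall s, f s = g s) -> f = g.
Proof.
case: f g => [f wf] [g wg] /= /funext fg.
by move: wf wg; rewrite fg => wf wg; congr Hahn; exact: Prop_irrelevance.
Qed.

Definition hsupp f : set R := [set s | f s != 0].

Lemma hsuppN f s : ~ hsupp f s -> f s = 0.
Proof. by move=> /negP; rewrite negbK => /eqP. Qed.

Lemma hzero_wo : well_ordered [set s : R | (0 : K) != 0].
Proof.
by apply: (well_ordered_sub _ (@well_ordered0 R)) => s /=; rewrite eqxx.
Qed.
Definition hzero := Hahn hzero_wo.

Lemma hopp_wo f : well_ordered [set s | - f s != 0].
Proof.
by apply: (well_ordered_sub _ (hsupp_wo f)) => s /=; rewrite oppr_eq0.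
Qed.
Definition hopp f := Hahn (@hopp_wo f).

Lemma hadd_wo f g : well_ordered [set s | f s + g s != 0].
Proof.
apply: (well_ordered_sub _ (well_orderedU (hsupp_wo f) (hsupp_wo g))) => s /=.
have [->|] := eqVneq (f s) 0; last by left.
by rewrite add0r; right.
Qed.
Definition hadd f g := Hahn (@hadd_wo f g).

Fact haddA : associative hadd.
Proof. by move=> f g h; apply: hahnP => s /=; rewrite addrA. Qed.
Fact haddC : commutative hadd.
Proof. by move=> f g; apply: hahnP => s /=; rewrite addrC. Qed.
Fact hadd0 : left_id hzero hadd.
Proof. by move=> f; apply: hahnP => s /=; rewrite add0r. Qed.
Fact haddN : left_inverse hzero hopp hadd.
Proof. by move=> f; apply: hahnP => s /=; rewrite addNr. Qed.
HB.instance Definition _ := GRing.isZmodule.Build hahn haddA haddC hadd0 haddN.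

(* \sum_(a \in A) is the finite sum over the nonzero terms. *)
Definition hconv f g (s : R) : K := \sum_(a \in [set: R]) f a * g (s - a).

Lemma hconv_fin f g s :
  finite_set [set a | hsupp f a /\ hsupp g (s - a)].
Proof. exact: finite_sumset_fiber (hsupp_wo f) (hsupp_wo g). Qed.

Lemma hconvE f g s (A : {fset R}) :
    (forall a, hsupp f a -> hsupp g (s - a) -> a \in A) ->
  hconv f g s = \sum_(a <- A) f a * g (s - a).
Proof.
move=> fgA; apply: fsbigTE => a aA.
have [fa|/hsuppN ->] := pselect (hsupp f a); last by rewrite mul0r.
have [ga|/hsuppN ->] := pselect (hsupp g (s - a)); last by rewrite mulr0.
by rewrite fgA in aA.
Qed.

Lemma hconv_supp f g s : hconv f g s != 0 -> sumset (hsupp f) (hsupp g) s.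
Proof.
move=> /eqP h; apply: contrapT => nfg; apply: h.
apply: fsbig1 => a _.
have [fa|/hsuppN ->] := pselect (hsupp f a); last by rewrite mul0r.
have [ga|/hsuppN ->] := pselect (hsupp g (s - a)); last by rewrite mulr0.
by case: nfg; exists a.
Qed.

Lemma hmul_wo f g : well_ordered [set s | hconv f g s != 0].
Proof.
apply: (well_ordered_sub _ (well_ordered_sumset (hsupp_wo f) (hsupp_wo g))).
exact: hconv_supp.
Qed.
Definition hmul f g := Hahn (@hmul_wo f g).

Lemma hmono_wo (c : K) (r : R) :
  well_ordered [set s | (if s == r then c else 0) != 0].
Proof.
apply: (well_ordered_sub _ (@well_ordered1 R r)) => s /=.
by have [//|_] := eqVneq s r; rewrite eqxx.
Qed.
(* c x^r *)
Definition hmono c r := Hahn (@hmono_wo c r).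

Fact hmulC : commutative hmul.
Proof.
move=> f g; apply: hahnP => s /=; rewrite /hconv.
rewrite (reindex_fsbigT (fun a => s - a)); last first.
  by exists (fun a => s - a) => a; rewrite subKr.
by apply: eq_fsbigr => a _; rewrite subKr mulrC.
Qed.

Lemma hmul_monol c r f s : hmul (hmono c r) f s = c * f (s - r).
Proof.
rewrite /= (@hconvE _ _ _ [fset r]%fset) ?big_seq_fset1 /= ?eqxx// => a.
by rewrite /hsupp/= inE; have [//|] := eqVneq a r; rewrite eqxx.
Qed.

Lemma fset_of (A : set R) : finite_set A ->
  exists F : {fset R}, forall a, A a -> a \in F.
Proof.
by move=> finA; exists (fset_set A) => a Aa; rewrite in_fset_set// inE.
Qed.

Fact hmulA : associative hmul.
Proof.
move=> f g h; apply: hahnP => s /=.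
have [A HA] := fset_of (finite_sumset_fiber s (hsupp_wo f)
  (well_ordered_sumset (hsupp_wo g) (hsupp_wo h))).
have [B HB] := fset_of (finite_sumset_fiber s
  (well_ordered_sumset (hsupp_wo f) (hsupp_wo g)) (hsupp_wo h)).
rewrite (@hconvE f (hmul g h) s A); last first.
  by move=> a fa /hconv_supp gha; exact: HA.
rewrite (@hconvE (hmul f g) h s B); last first.
  by move=> b /hconv_supp fgb hb; exact: HB.
transitivity (\sum_(a <- A) \sum_(b <- B) f a * g (b - a) * h (s - b)).
  apply: eq_bigr => a _ /=.
  have [fa|/hsuppN fa0] := pselect (hsupp f a); last first.
    by rewrite fa0 mul0r big1// => b _; rewrite !mul0r.
  rewrite (_ : hconv g h (s - a) =
      \sum_(b \in [set: R]) g (b - a) * h (s - b)); last first.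
    rewrite /hconv (reindex_fsbigT (fun b => b - a)); last first.
      by exists (fun b => b + a) => b; rewrite ?subrK ?addrK.
    by apply: eq_fsbigr => b _; rewrite opprB addrA subrK.
  rewrite (fsbigTE B); last first.
    move=> b bB.
    have [gb|/hsuppN ->] := pselect (hsupp g (b - a)); last by rewrite mul0r.
    have [hb|/hsuppN ->] := pselect (hsupp h (s - b)); last by rewrite mulr0.
    by move: bB; rewrite HB//; split=> //; exists a.
  by rewrite mulr_sumr; apply: eq_bigr => b _; rewrite mulrA.
rewrite exchange_big; apply: eq_bigr => b _ /=.
have [hb|/hsuppN hb0] := pselect (hsupp h (s - b)); last first.
  by rewrite hb0 mulr0 big1// => a _; rewrite mulr0.
rewrite (@hconvE f g b A) ?mulr_suml// => a fa gb; apply: HA; split=> //.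
by exists (b - a) => //; rewrite opprB addrA subrK.
Qed.

Fact hmul1 : left_id (hmono 1 0) hmul.
Proof. by move=> f; apply: hahnP => s; rewrite hmul_monol mul1r subr0. Qed.

Fact hmulDl : left_distributive hmul hadd.
Proof.
move=> f g h; apply: hahnP => s /=.
have [A HA] := fset_of (hconv_fin f h s).
have [B HB] := fset_of (hconv_fin g h s).
have inA a : hsupp f a -> hsupp h (s - a) -> a \in (A `|` B)%fset.
  by move=> fa ha; rewrite in_fsetU HA.
have inB a : hsupp g a -> hsupp h (s - a) -> a \in (A `|` B)%fset.
  by move=> ga ha; rewrite in_fsetU HB ?orbT.
rewrite (@hconvE f h s (A `|` B)%fset)// (@hconvE g h s (A `|` B)%fset)//.
rewrite (@hconvE (hadd f g) h s (A `|` B)%fset).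
  by rewrite -big_split /=; apply: eq_bigr => a _; rewrite mulrDl.
move=> a fga ha; have [fa|/hsuppN fa0] := pselect (hsupp f a); first exact: inA.
by apply: inB => //; move: fga; rewrite /hsupp /= fa0 add0r.
Qed.

Fact hone_neq0 : hmono 1 0 != 0.
Proof.
apply/eqP => /(congr1 (fun f : hahn => f 0)) /=.
by rewrite eqxx => /eqP; rewrite oner_eq0.
Qed.
HB.instance Definition _ :=
  GRing.Zmodule_isComNzRing.Build hahn hmulA hmulC hmul1 hmulDl hone_neq0.

Lemma hcoef0 s : (0 : hahn) s = 0. Proof. by []. Qed.
Lemma hcoefD f g s : (f + g) s = f s + g s. Proof. by []. Qed.
Lemma hcoefN f s : (- f) s = - f s. Proof. by []. Qed.
Lemma hcoefM f g s : (f * g) s = hconv f g s. Proof. by []. Qed.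
Lemma hcoef_mono c r s : hmono c r s = if s == r then c else 0. Proof. by []. Qed.
Lemma hcoef_monoM c r f s : (hmono c r * f) s = c * f (s - r).
Proof. exact: hmul_monol. Qed.
Lemma hcoef_sum I (r : seq I) (P : pred I) (F : I -> hahn) s :
  (\sum_(i <- r | P i) F i) s = \sum_(i <- r | P i) F i s.
Proof. by elim/big_rec2: _ => // i x y _ <-. Qed.

Lemma hmonoM c d r s : hmono c r * hmono d s = hmono (c * d) (r + s).
Proof.
apply: hahnP => u; rewrite hcoef_monoM !hcoef_mono.
rewrite subr_eq addrC; case: ifP => _ //; exact: mulr0.
Qed.

Definition hconst c : hahn := hmono c 0.

Fact hconst_zmod : zmod_morphism hconst.
Proof.
move=> c d; apply: hahnP => s; rewrite hcoefD hcoefN !hcoef_mono.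
by case: ifP; rewrite ?subr0.
Qed.
HB.instance Definition _ := GRing.isZmodMorphism.Build K hahn hconst hconst_zmod.
Fact hconst_monoid : monoid_morphism hconst.
Proof. by split=> // c d; rewrite /hconst hmonoM addr0. Qed.
HB.instance Definition _ := GRing.isMonoidMorphism.Build K hahn hconst hconst_monoid.

(* ord_x, with the convention that ord_x 0 is the (irrelevant) real inf set0 *)
Definition hord f : R := inf (hsupp f).

Lemma hsupp_neq0 f : f != 0 -> hsupp f !=set0.
Proof.
move=> /eqP f0; apply: contrapT => /nonemptyPn s0; apply: f0; apply: hahnP => s.
by apply: hsuppN; rewrite s0.
Qed.

Lemma hord_unique f s : f s != 0 -> (forall r, f r != 0 -> s <= r) -> hord f = s.
Proof.
move=> fs fmin; apply/eqP; rewrite eq_le; apply/andP; split.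
  by apply: ge_inf => //; exists s.
by apply: lb_le_inf => //; exists s.
Qed.

Lemma hord_coef f : f != 0 -> f (hord f) != 0.
Proof.
move=> /hsupp_neq0 f0; have [m fm mmin] := hsupp_wo f _ (@subset_refl _ _) f0.
by rewrite (hord_unique fm mmin).
Qed.

Lemma hord_le f s : f s != 0 -> hord f <= s.
Proof.
move=> fs; have f0 : hsupp f !=set0 by exists s.
have [m fm mmin] := hsupp_wo f _ (@subset_refl _ _) f0.
by rewrite (hord_unique fm mmin); exact: mmin.
Qed.

Lemma hord_lt f s : s < hord f -> f s = 0.
Proof. by apply: contraPeq => /hord_le; rewrite leNgt => /negP. Qed.

Lemma hord_ge f r : f != 0 -> (forall s, f s != 0 -> r <= s) -> r <= hord f.
Proof. by move=> f0; apply; exact: hord_coef. Qed.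

Lemma hordD f g : f + g != 0 ->
  (f != 0 -> g != 0 -> Order.min (hord f) (hord g) <= hord (f + g)).
Proof.
move=> fg0 f0 g0; apply: hord_ge => // s; rewrite hcoefD => fgs.
rewrite ge_min; have [fs0|/hord_le -> //] := eqVneq (f s) 0.
by move: fgs; rewrite fs0 add0r => /hord_le ->; rewrite orbT.
Qed.

End HahnSeries.
Arguments hsupp_wo {R K} h.

Section HahnDomain.
Variables (R : realType) (K : idomainType).
Implicit Types f g : hahn R K.

Lemma hcoefM_hord f g :
  (f * g) (hord f + hord g) = f (hord f) * g (hord g).
Proof.
rewrite hcoefM (@hconvE _ _ _ _ _ [fset hord f]%fset).
  by rewrite big_seq_fset1 [hord f + _]addrC addrK.
move=> a /hord_le fa /hord_le ga; rewrite inE eq_le fa andbT; lra.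
Qed.

Lemma hmul_neq0 f g : f != 0 -> g != 0 -> f * g != 0.
Proof.
move=> f0 g0; apply: contra_neq (_ : (f * g) (hord f + hord g) != 0).
  by move=> ->.
by rewrite hcoefM_hord mulf_neq0 ?hord_coef.
Qed.

Lemma hordM f g : f != 0 -> g != 0 -> hord (f * g) = hord f + hord g.
Proof.
move=> f0 g0; apply: hord_unique.
  by rewrite hcoefM_hord mulf_neq0 ?hord_coef.
move=> r /hconv_supp[a /hord_le fa /hord_le ga]; lra.
Qed.

End HahnDomain.

(* C[x,y] is represented as C[x][y]: the variable x is 'X%:P and y is 'X. *)
Notation bipoly R := {poly {poly R[i]}}.
Notation ratfun R := {fraction (bipoly R)}.
Notation "f %:F" := (@FracField.tofrac _ f) : ring_scope.

(* Series with coefficients in C[theta], where theta = 'X. *)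
Notation thseries R := (hahn R {poly R[i]}).

Section Valuations.
Variable R : realType.

(* f`_j`_i is the coefficient of x^i y^j. *)
Definition deg_le (d : nat) (f : bipoly R) : Prop :=
  forall i j, f`_j`_i != 0 -> (i + j <= d)%N.

(* An element of T: a map F^* -> R; the value at 0 is fixed to the irrelevant
   value 0, so that equality of valuations is equality on F^*.  A valuation that
   is nonnegative on C[x,y] has as center the point of the prime ideal
   {f | v(f) > 0}. *)
Record valuation := Valuation {
  vfun :> (ratfun R) -> R ;
  vfun0 : vfun 0 = 0 ;
  vfunM : forall f g, f != 0 -> g != 0 -> vfun (f * g) = vfun f + vfun g ;
  vfunD : forall f g, f != 0 -> g != 0 -> f + g != 0 ->
    Num.min (vfun f) (vfun g) <= vfun (f + g) ;
  vfun_ge0 : forall f : bipoly R, f != 0 -> 0 <= vfun f%:F ;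
  vfun_center : forall f : bipoly R, f != 0 ->
    (0 < vfun f%:F <-> f.[0].[0] = 0) ;
  vfun_norm : Num.min (vfun ('X%:P : bipoly R)%:F) (vfun ('X : bipoly R)%:F) = 1 }.

HB.instance Definition _ := gen_eqMixin valuation.
HB.instance Definition _ := gen_choiceMixin valuation.

(* max {v(f) | f != 0, deg f <= d}; the supremum is attained, since v takes at
   most dim V values on the nonzero elements of a finite-dimensional space V. *)
Definition max_val (v : valuation) (d : nat) : \bar R :=
  ereal_sup [set (v f%:F)%:E | f in [set f : bipoly R | f != 0 /\ deg_le d f]].

(* The limit can be +oo, e.g. at v(xi, +oo) for xi a transcendental power
   series: by a dimension count max_val grows quadratically there. *)
Definition mu_hat (v : valuation) : \bar R :=
  limn (fun d : nat => (d%:R^-1)%:E * max_val v d)%E.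

Definition hscalar : R[i] -> (thseries R) := @hconst R {poly R[i]} \o polyC.
HB.instance Definition _ := GRing.RMorphism.on hscalar.
Definition hX : thseries R := hmono 1 1.

Definition evalx : {poly R[i]} -> (thseries R) := horner_eval hX \o map_poly hscalar.
HB.instance Definition _ := GRing.RMorphism.on evalx.

(* f(x, eta) *)
Definition subst (eta : thseries R) : bipoly R -> (thseries R) :=
  horner_eval eta \o map_poly evalx.
HB.instance Definition _ eta := GRing.RMorphism.on (subst eta).

(* xi(x) = \sum_j a_j x^(beta_j); the a_j may vanish, so finite sums (and 0) are
   included, and the beta_j may be bounded.  The bound beta_0 >= 1 makes v(xi, t)
   centered at the origin and normalized. *)
Record ratseries := RatSeries {
  scoef : nat -> R[i] ;
  sexp : nat -> rat ;
  sexp_incr : forall i j, (i < j)%N -> sexp i < sexp j ;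
  sexp_ge1 : 1 <= sexp 0 }.

Definition series_coef (xi : ratseries) (s : R) : {poly R[i]} :=
  (\sum_(j \in [set j | ratr (sexp xi j) = s]) scoef xi j)%:P.

Lemma series_coef_supp xi s : series_coef xi s != 0 ->
  exists j, s = ratr (sexp xi j).
Proof.
move=> /eqP h; apply: contrapT => nj; apply: h.
rewrite /series_coef fsbig1 ?polyC0// => j /= js.
by case: nj; exists j.
Qed.

Lemma series_wo xi : well_ordered [set s | series_coef xi s != 0].
Proof.
move=> B Bxi [b Bb].
have ex : exists j, `[< B (ratr (sexp xi j)) >].
  by have [j bE] := series_coef_supp (Bxi _ Bb); exists j; rewrite -bE; exact/asboolP.
case: (ex_minnP ex) => m /asboolP Bm mmin; exists (ratr (sexp xi m)) => // c Bc.
have [j cE] := series_coef_supp (Bxi _ Bc); rewrite cE ler_rat.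
have : (m <= j)%N by apply: mmin; apply/asboolP; rewrite -cE.
by rewrite leq_eqVlt => /orP[/eqP -> //|/sexp_incr/ltW].
Qed.

Definition hseries (xi : ratseries) : thseries R := Hahn (@series_wo xi).

(* y = xi(x) parametrizes a branch of an algebraic curve f = 0, which passes
   through the origin since xi has positive order; by Newton-Puiseux such a xi is
   a convergent Puiseux series. *)
Definition curve_branch (xi : ratseries) : Prop :=
  exists2 f : bipoly R, f != 0 & subst (hseries xi) f = 0.

(* xi(x) + theta x^t, with x^(+oo) = 0 *)
Definition qm_series (xi : ratseries) (t : \bar R) : thseries R :=
  hseries xi + (if t is r%:E then hmono 'X r else 0).

Definition qm_dom (xi : ratseries) : set (\bar R) :=
  [set t | (1 <= t)%E /\ (t = +oo%E -> ~ curve_branch xi)].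

(* ord_x f(x, xi(x) + theta x^t), after exchanging x and y in f if b holds *)
Definition qm_ord (xi : ratseries) (b : bool) (t : \bar R) (f : bipoly R) : R :=
  hord (subst (qm_series xi t) (if b then swapXY f else f)).

(* w extended from C[x,y] to F by w(n / d) = w(n) - w(d) *)
Definition frac_ext (w : bipoly R -> R) (q : ratfun R) : R :=
  if q == 0 then 0
  else w (fraction.frac (repr q)).1 - w (fraction.frac (repr q)).2.

Lemma frac_reprE (q : ratfun R) :
  q * (fraction.frac (repr q)).2%:F = (fraction.frac (repr q)).1%:F.
Proof.
have := denom_ratioP (repr q); set d := (fraction.frac _).2 => d0.
rewrite -[q in LHS]reprK; unlock FracField.tofrac.
rewrite -[LHS]FracField.pi_mul; apply/eqmodP.
rewrite /= FracField.equivfE /FracField.mulf /= !fraction.numden_Ratio ?mulr1 ?oner_neq0//.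
by rewrite mulrC.
Qed.

Lemma frac_neq0 (f : bipoly R) : f != 0 -> f%:F != 0 :> ratfun R.
Proof. by rewrite tofrac_eq0. Qed.

Lemma frac_inj : injective (@FracField.tofrac (bipoly R)).
Proof. by move=> f g /eqP; rewrite tofrac_eq => /eqP. Qed.

Section FracExt.
Variable w : bipoly R -> R.
Hypothesis wM : forall f g, f != 0 -> g != 0 -> w (f * g) = w f + w g.
Hypothesis wD : forall f g, f != 0 -> g != 0 -> f + g != 0 ->
  Num.min (w f) (w g) <= w (f + g).

Lemma frac_ext0 : frac_ext w 0 = 0.
Proof. by rewrite /frac_ext eqxx. Qed.

Lemma frac_extE (q : ratfun R) (n d : bipoly R) : n != 0 -> d != 0 ->
  q * d%:F = n%:F -> frac_ext w q = w n - w d.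
Proof.
move=> n0 d0 qdn.
have q0 : q != 0.
  by apply: contraNneq (frac_neq0 n0) => q0; rewrite -qdn q0 mul0r.
rewrite /frac_ext (negPf q0).
have := frac_reprE q; have := denom_ratioP (repr q).
case: (fraction.frac _) => r1 r2 /= r20 qr.
have r10 : r1 != 0.
  by apply: contraNneq (mulf_neq0 q0 (frac_neq0 r20)) => r10; rewrite qr r10 tofrac0.
have : r1 * d = n * r2.
  apply: (@frac_inj); rewrite !tofracM -qr -qdn; exact: mulrAC.
by move=> /(congr1 w); rewrite !wM//; lra.
Qed.

Lemma frac_ext_poly (f : bipoly R) : f != 0 -> frac_ext w f%:F = w f.
Proof.
move=> f0; rewrite (@frac_extE _ f 1) ?oner_neq0 ?tofrac1 ?mulr1//.
have := wM (oner_neq0 (bipoly R)) (oner_neq0 (bipoly R)); rewrite mulr1; lra.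
Qed.

Lemma frac_numden (q : ratfun R) : q != 0 ->
  exists n d : bipoly R, [/\ n != 0, d != 0 & q * d%:F = n%:F].
Proof.
move=> q0; have := frac_reprE q; have := denom_ratioP (repr q).
case: (fraction.frac _) => n d /= d0 qE; exists n, d; split=> //.
apply: contraNneq (mulf_neq0 q0 (frac_neq0 d0)) => n0.
by rewrite qE n0 tofrac0.
Qed.

Lemma frac_extM (p q : ratfun R) : p != 0 -> q != 0 ->
  frac_ext w (p * q) = frac_ext w p + frac_ext w q.
Proof.
move=> /frac_numden[n [d [n0 d0 pE]]] /frac_numden[n' [d' [n'0 d'0 qE]]].
rewrite (@frac_extE (p * q) (n * n') (d * d')) ?mulf_neq0//; last first.
  by rewrite !tofracM -pE -qE mulrACA.
by rewrite (frac_extE n0 d0 pE) (frac_extE n'0 d'0 qE) !wM//; lra.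
Qed.

Lemma frac_extD (p q : ratfun R) : p != 0 -> q != 0 -> p + q != 0 ->
  Num.min (frac_ext w p) (frac_ext w q) <= frac_ext w (p + q).
Proof.
move=> /frac_numden[n [d [n0 d0 pE]]] /frac_numden[n' [d' [n'0 d'0 qE]]] pq0.
have sE : (p + q) * (d * d')%:F = (n * d' + n' * d)%:F.
  rewrite tofracD !tofracM -pE -qE; ring.
have s0 : n * d' + n' * d != 0.
  have dd := mulf_neq0 pq0 (frac_neq0 (mulf_neq0 d0 d'0)).
  by apply: contraNneq dd => s0; rewrite sE s0 tofrac0.
rewrite (frac_extE n0 d0 pE) (frac_extE n'0 d'0 qE).
rewrite (frac_extE s0 (mulf_neq0 d0 d'0) sE) wM//.
have := wD (mulf_neq0 n0 d'0) (mulf_neq0 n'0 d0) s0; rewrite !wM// !ge_min.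
by move=> /orP[] h; apply/orP; [left|right]; lra.
Qed.

End FracExt.

(* h = c + terms of exponent at least 1 *)
Definition near1 (c : R[i]) (h : thseries R) :=
  forall s, (h - hscalar c) s != 0 -> 1 <= s.

Lemma near1_ge0 c h s : near1 c h -> h s != 0 -> 0 <= s.
Proof.
move=> /(_ s); rewrite hcoefD hcoefN hcoef_mono.
have [->//|s0] := eqVneq s 0; rewrite subr0 => h1 /h1; exact: le_trans.
Qed.

Lemma near1D c d g h : near1 c g -> near1 d h -> near1 (c + d) (g + h).
Proof.
move=> cg dh s.
have -> : g + h - hscalar (c + d) = (g - hscalar c) + (h - hscalar d).
  by rewrite rmorphD opprD addrACA.
rewrite hcoefD.
have [->|/cg//] := eqVneq ((g - hscalar c) s) 0.
by rewrite add0r => /dh.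
Qed.

Lemma near1_const c : near1 c (hscalar c).
Proof. by move=> s; rewrite subrr eqxx. Qed.

Lemma near10 : near1 0 0.
Proof. by move=> s; rewrite raddf0 subr0 eqxx. Qed.

Lemma near1M c g h : near1 c g -> near1 0 h -> near1 0 (g * h).
Proof.
move=> cg h1 s; rewrite rmorph0 subr0 hcoefM => /hconv_supp[a ga ha].
have a0 := near1_ge0 cg ga.
have := h1 (s - a); rewrite rmorph0 subr0 => /(_ ha); lra.
Qed.

Lemma near1X : near1 0 hX.
Proof.
move=> s; rewrite rmorph0 subr0 hcoef_mono.
by have [->//|_] := eqVneq s 1; rewrite eqxx.
Qed.

Lemma evalxX : evalx 'X = hX.
Proof. by rewrite /evalx /= map_polyX /horner_eval hornerX. Qed.
Lemma evalxC c : evalx c%:P = hscalar c.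
Proof. by rewrite /evalx /= map_polyC /horner_eval hornerC. Qed.
Lemma substX eta : subst eta 'X = eta.
Proof. by rewrite /subst /= map_polyX /horner_eval hornerX. Qed.
Lemma substC eta p : subst eta p%:P = evalx p.
Proof. by rewrite /subst /= map_polyC /horner_eval hornerC. Qed.

Lemma near1_evalx p : near1 p.[0] (evalx p).
Proof.
elim/poly_ind: p => [|p c IH]; first by rewrite raddf0 horner0; exact: near10.
rewrite hornerD hornerM hornerX hornerC mulr0 rmorphD rmorphM /= evalxX evalxC.
exact: (near1D (near1M IH near1X) (@near1_const c)).
Qed.

Lemma near1_subst eta f : near1 0 eta -> near1 f.[0].[0] (subst eta f).
Proof.
move=> eta1; elim/poly_ind: f => [|f p IH].
  by rewrite raddf0 !horner0; exact: near10.
rewrite hornerD hornerM hornerX hornerC mulr0 rmorphD rmorphM /= substX substC.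
by rewrite hornerD horner0; exact: (near1D (near1M IH eta1) (@near1_evalx p)).
Qed.

Lemma near1_hord h : near1 0 h -> h != 0 -> 1 <= hord h.
Proof.
move=> h1 h0; apply: hord_ge => // s hs; apply: h1.
by rewrite rmorph0 subr0.
Qed.

Lemma near1_hord_neq0 c h : near1 c h -> c != 0 -> hord h = 0.
Proof.
move=> hc c0; apply: hord_unique; last by move=> r; exact: near1_ge0 hc.
apply: contraNneq c0 => h0; have := hc 0.
rewrite hcoefD h0 add0r hcoefN hcoef_mono eqxx oppr_eq0 polyC_eq0.
by case: eqP => // _ /(_ isT); rewrite ler10.
Qed.

Lemma series_ge1 xi s : hseries xi s != 0 -> 1 <= s.
Proof.
move=> /series_coef_supp[j ->].
rewrite -[1](ratr_nat R 1) ler_rat; apply: le_trans (sexp_ge1 xi) _.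
by case: j => // j; apply: ltW; exact: sexp_incr.
Qed.

Lemma qm_series_ge1 xi t : (1 <= t)%E -> near1 0 (qm_series xi t).
Proof.
move=> t1 s; rewrite rmorph0 subr0 /qm_series hcoefD.
have [->|/series_ge1//] := eqVneq (hseries xi s) 0.
rewrite add0r; case: t t1 => [r r1|_|_]; last 2 first.
- by rewrite hcoef0 eqxx.
- by rewrite hcoef0 eqxx.
by rewrite lee_fin in r1; rewrite hcoef_mono; have [->//|_] := eqVneq s r; rewrite eqxx.
Qed.

(* the theta-degree of f(x, xi + theta x^r) is the degree of f in y *)
Lemma theta_top xi r n s :
  (size ((qm_series xi r%:E ^+ n) s) <= n.+1)%N /\
  ((qm_series xi r%:E ^+ n) s)`_n = (s == r *+ n)%:R.
Proof.
elim: n s => [|n IH] s.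
  rewrite expr0 hcoef_mono mulr0n; case: ifP => _; last by rewrite size_poly0 coef0.
  by rewrite size_poly1 coef1.
rewrite exprS /qm_series mulrDl -/(qm_series xi r%:E).
set h := qm_series _ _ ^+ n in IH *.
rewrite hcoefD hcoef_monoM.
have sz : (size ((hseries xi * h)%R s) <= n.+1)%N.
  rewrite hcoefM /hconv; elim/big_ind: _; first by rewrite size_poly0.
    by move=> p q ps qs; rewrite (leq_trans (size_polyD _ _))// geq_max ps.
  move=> a _; rewrite /= /series_coef mul_polyC.
  by rewrite (leq_trans (size_scale_leq _ _))// (IH _).1.
split.
  rewrite (leq_trans (size_polyD _ _))// geq_max (leq_trans sz)//=.
  by rewrite (leq_trans (size_polyMleq _ _))// size_polyX /= ltnS (IH _).1.
by rewrite coefD nth_default// add0r coefXM /= (IH _).2 subr_eq mulrSr.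
Qed.

Lemma evalxE p : evalx p = \sum_(k < size p) hmono (p`_k)%:P k%:R.
Proof.
rewrite /evalx /= /horner_eval (@horner_coef_wide _ (size p)); last exact: size_poly.
apply: eq_bigr => k _; rewrite coef_map /=.
have -> : hX ^+ k = hmono 1 k%:R.
  elim: (k : nat) => [//|m IHm].
  by rewrite exprS IHm /hX hmonoM mulr1 -natr1 addrC.
by rewrite /hscalar /= /hconst hmonoM mulr1 add0r.
Qed.

Lemma subst_fin_neq0 xi r f : f != 0 -> subst (qm_series xi r%:E) f != 0.
Proof.
move=> f0; set eta := qm_series _ _.
have fE : subst eta f = \sum_(j < size f) evalx f`_j * eta ^+ j.
  rewrite /subst /= /horner_eval (@horner_coef_wide _ (size f)); last exact: size_poly.
  by apply: eq_bigr => j _; rewrite coef_map.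
have evM p h s : (evalx p * h) s = \sum_(k < size p) (p`_k)%:P * h (s - k%:R).
  rewrite evalxE mulr_suml hcoef_sum; apply: eq_bigr => k _.
  by rewrite hcoef_monoM.
have szf : (size f).-1.+1 = size f by rewrite prednK// size_poly_gt0.
set n := (size f).-1 in szf.
have p0 : f`_n != 0 by rewrite -lead_coefE lead_coef_eq0.
set p := f`_n in p0.
pose m := (size p).-1; pose s := r *+ n + m%:R.
have szp : m.+1 = size p by rewrite prednK// size_poly_gt0.
suff : (subst eta f s)`_n != 0.
  by apply: contra_neq => ->; rewrite hcoef0 coef0.
rewrite fE hcoef_sum -szf big_ord_recr coefD coef_sum big1 ?add0r; last first.
  move=> j _; rewrite evM coef_sum big1// => k _.
  rewrite coefCM [X in _ * X]nth_default ?mulr0//.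
  by rewrite (leq_trans (theta_top xi r _ _).1)//=.
rewrite evM coef_sum -/p -szp big_ord_recr /= big1 ?add0r.
  by rewrite coefCM (theta_top _ _ _ _).2 /s addrK eqxx mulr1 -lead_coefE lead_coef_eq0.
move=> k _; rewrite coefCM (theta_top _ _ _ _).2 /s.
case: eqP => [/eqP|_]; last exact: mulr0.
rewrite -addrA -[X in _ == X]addr0 (inj_eq (addrI _)) subr_eq0 eqr_nat => /eqP mk.
by have := ltn_ord k; rewrite -mk ltnn.
Qed.

Lemma hord_X : hord hX = 1 :> R.
Proof.
apply: hord_unique; first by rewrite hcoef_mono eqxx oner_neq0.
by move=> r; rewrite hcoef_mono; have [->//|_] := eqVneq r 1; rewrite eqxx.
Qed.

Section QuasiMonomial.
Variables (xi : ratseries) (b : bool) (t : \bar R).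
Hypothesis dt : qm_dom xi t.

Let eta := qm_series xi t.
Let sw (f : bipoly R) := if b then swapXY f else f.

Let sw_neq0 f : f != 0 -> sw f != 0.
Proof. by rewrite /sw; case: b => //; rewrite swapXY_eq0. Qed.

Lemma qm_subst_neq0 f : f != 0 -> subst eta (sw f) != 0.
Proof.
move=> /sw_neq0 f0; rewrite /eta; case: t dt => [r _| [_ nb]|[]//].
  exact: subst_fin_neq0.
rewrite /qm_series addr0; apply/eqP => E; apply: (nb erefl).
by exists (sw f).
Qed.

Let eta1 : near1 0 eta. Proof. exact: qm_series_ge1 dt.1. Qed.

Let swM : {morph sw : f g / f * g}.
Proof. by move=> f g; rewrite /sw; case: b; rewrite ?rmorphM. Qed.
Let swD : {morph sw : f g / f + g}.
Proof. by move=> f g; rewrite /sw; case: b; rewrite ?rmorphD. Qed.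

Fact qm_ordM f g : f != 0 -> g != 0 ->
  qm_ord xi b t (f * g) = qm_ord xi b t f + qm_ord xi b t g.
Proof.
by move=> f0 g0; rewrite /qm_ord -!/(sw _) swM rmorphM hordM//; exact: qm_subst_neq0.
Qed.

Fact qm_ordD f g : f != 0 -> g != 0 -> f + g != 0 ->
  Num.min (qm_ord xi b t f) (qm_ord xi b t g) <= qm_ord xi b t (f + g).
Proof.
move=> f0 g0 /qm_subst_neq0; rewrite /qm_ord -!/(sw _) swD rmorphD => fg0.
by apply: hordD => //; exact: qm_subst_neq0.
Qed.

Let sw00 f : (sw f).[0].[0] = f.[0].[0].
Proof.
rewrite /sw; case: b => //; rewrite -[0 in LHS]polyC0.
by rewrite horner2_swapXY polyC0.
Qed.

Fact qm_ord_ge0 f : f != 0 -> 0 <= frac_ext (qm_ord xi b t) f%:F.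
Proof.
move=> f0; rewrite (frac_ext_poly qm_ordM)//.
apply: hord_ge => [|s]; first exact: qm_subst_neq0.
exact: (near1_ge0 (@near1_subst _ (sw f) eta1)).
Qed.

Fact qm_ord_center f : f != 0 ->
  (0 < frac_ext (qm_ord xi b t) f%:F <-> f.[0].[0] = 0).
Proof.
move=> f0; rewrite (frac_ext_poly qm_ordM)// /qm_ord -/(sw f) -/eta.
have := @near1_subst _ (sw f) eta1; rewrite sw00 => h.
split=> [|f00]; last first.
  by rewrite f00 in h; apply: lt_le_trans (near1_hord h (qm_subst_neq0 f0)).
by apply: contraTeq => /(near1_hord_neq0 h) ->; rewrite ltxx.
Qed.

Fact qm_ord_norm :
  Num.min (frac_ext (qm_ord xi b t) ('X%:P : bipoly R)%:F)
          (frac_ext (qm_ord xi b t) ('X : bipoly R)%:F) = 1.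
Proof.
have X0 : ('X : bipoly R) != 0 by rewrite polyX_eq0.
have Y0 : ('X%:P : bipoly R) != 0 by rewrite polyC_eq0 polyX_eq0.
have eta_ge1 : 1 <= hord eta.
  apply: near1_hord; first exact: eta1.
  rewrite -(substX eta).
  have := @qm_subst_neq0 (sw 'X); rewrite /sw; case: b; rewrite ?swapXYK; apply.
    by rewrite swapXY_eq0.
  exact: X0.
rewrite !(frac_ext_poly qm_ordM)// /qm_ord -/eta; case: b.
  by rewrite swapXY_X swapXY_Y substC evalxX substX hord_X minC; exact/min_idPl.
by rewrite substC evalxX substX hord_X; exact/min_idPl.
Qed.

End QuasiMonomial.

(* v(xi, t), with the roles of x and y exchanged if b holds *)
Definition qm_val (xi : ratseries) (b : bool) (t : qm_dom xi) : valuation :=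
  let dt : qm_dom xi (val t) := set_mem (valP t) in
  Valuation (frac_ext0 (qm_ord xi b (val t)))
    (frac_extM (@qm_ordM xi b _ dt))
    (frac_extD (@qm_ordM xi b _ dt) (@qm_ordD xi b _ dt))
    (@qm_ord_ge0 xi b _ dt) (@qm_ord_center xi b _ dt)
    (@qm_ord_norm xi b _ dt).

(* the coarsest topology making all the maps v |-> v(f), f != 0, continuous *)
Definition weak_val :=
  sup_topology (fun f : {f : ratfun R | f != 0} =>
    Topological.on (initial_topology (fun v : valuation => v (sval f)))).
HB.instance Definition _ := Topological.on weak_val.

(* the finest topology making all the maps t |-> v(xi, t) continuous, for both
   roles of x and y; qm_dom xi is [1, +oo] or [1, +oo[ with the topology induced
   by the extended reals *)
Definition strong_open (U : set valuation) : Prop :=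
  forall (xi : ratseries) (b : bool), open (@qm_val xi b @^-1` U).

Fact strong_openT : strong_open setT.
Proof. by move=> xi b; rewrite preimage_setT; exact: openT. Qed.
Fact strong_openI : setI_closed strong_open.
Proof.
by move=> U V oU oV xi b; rewrite preimage_setI; apply: openI; [exact: oU|exact: oV].
Qed.
Fact strong_open_bigU (I : Type) (U : I -> set valuation) :
  (forall i, strong_open (U i)) -> strong_open (\bigcup_i U i).
Proof.
move=> oU xi b; rewrite preimage_bigcup; apply: bigcup_open => i _; exact: oU.
Qed.

Definition strong_val := valuation.
HB.instance Definition _ := Choice.on strong_val.
HB.instance Definition _ := isOpenTopological.Build strong_val
  strong_openT strong_openI strong_open_bigU.

End Valuations.

(* Main.v *)
Require Import Defs.
From mathcomp Require Import all_boot all_order all_algebra.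
From mathcomp Require Import polyXY fraction complex.
From mathcomp Require Import all_classical all_reals all_analysis.
From mathcomp Require Import ring lra.
Import Order.TTheory GRing.Theory Num.Theory.
Import numFieldNormedType.Exports.
Local Open Scope classical_set_scope.
Local Open Scope ring_scope.

(** Taking powers of polynomials shows that the limit mu_hat v is the supremum
    of the slopes v(f) / d, over nonzero f of degree at most d and d >= 1
    (mu_hatE).  For fixed f and d the slope is a weakly continuous function of
    v, and a supremum of continuous functions is lower semicontinuous.

    For the strong topology, mu_hat has to be continuous along each curve
    t |-> v(xi, t).  Expanding f(x, xi + theta x^t) by Taylor's formula in
    powers of theta x^t gives
      v(xi, t)(f) = min_j (c_j + t j),   c_j = ord_x (f^`N(j)(x, xi)) >= 0,
    since theta is transcendental (hord_subst_le, hord_subst_eq).  From this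
    formula, for 1 <= t <= t' < +oo,
      v(xi, t)(f) <= v(xi, t')(f) <= (t' / t) v(xi, t)(f).
    These bounds are uniform in f, so mu_hat satisfies them as well, and they
    force continuity at every finite t.  At t = +oo, v(xi, t)(f) is eventually
    equal to v(xi, +oo)(f); hence mu_hat, which is nondecreasing in t,
    eventually exceeds any number below its value at +oo. *)

Set Implicit Arguments.
Unset Strict Implicit.
Unset Printing Implicit Defensive.

(** * The limit as a supremum of slopes *)

(** Convergence to a limit that also bounds the function reduces to a one-sided
    estimate, finite and infinite limits alike, because the topology of the
    extended reals is generated by open intervals. *)
Lemma cvge_from_below (R : realType) (T : Type) (F : set_system T) (FF : Filter F)
    (u : T -> \bar R) (s : \bar R) :
  (\forall x \near F, u x <= s)%E ->
  (forall a, a < s -> \forall x \near F, a < u x)%E -> u @ F --> s.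
Proof.
move=> us lu A; rewrite itv_nbhsE => -[[l r] [oi]] /=.
rewrite itv_boundlr => /andP[ls sr] iA.
have lo : \forall x \near F, (Order.le l (BLeft (u x))).
  case: l ls oi {iA} => [[] a|[]] //=.
  - by rewrite bnd_simp => /lu H _; apply: filterS H => x; rewrite bnd_simp.
  - by move=> _ _; exact: nearW.
apply: filterS2 us lo => x xs xl; apply: iA.
rewrite /= itv_boundlr xl /=; apply: le_trans sr.
by rewrite bnd_simp.
Qed.

Section Slope.
Variable R : realType.
Implicit Types (f g : bipoly R) (v : valuation R).

Lemma deg_le_leq d e f : (d <= e)%N -> deg_le d f -> deg_le e f.
Proof. by move=> de df i j /df/leq_trans; apply. Qed.

Lemma deg_leM d e f g : deg_le d f -> deg_le e g -> deg_le (d + e) (f * g).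
Proof.
move=> df eg i j; apply: contraNT; rewrite -ltnNge => deij.
rewrite coefM coef_sum big1// => -[k kj] _ /=; rewrite coefM big1// => -[l li] _ /=.
have [->|/df lk] := eqVneq f`_k`_l 0; first by rewrite mul0r.
have [->|/eg lk'] := eqVneq g`_(j - k)`_(i - l) 0; first by rewrite mulr0.
have : (i + j <= d + e)%N.
  rewrite ltnS in kj; rewrite ltnS in li.
  rewrite -(subnK kj) -(subnK li) addnACA addnC; exact: leq_add.
by rewrite leqNgt deij.
Qed.

Lemma deg_le1 d : deg_le d (1 : bipoly R).
Proof.
move=> i j; rewrite coef1; case: j => [|j]/=; last by rewrite coef0 eqxx.
by rewrite coef1; case: i => [|i]//=; rewrite eqxx.
Qed.

Lemma deg_leX d f k : deg_le d f -> deg_le (k * d) (f ^+ k).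
Proof.
move=> df; elim: k => [|k IH]; first by rewrite expr0; exact: deg_le1.
by rewrite exprS mulSn; exact: deg_leM.
Qed.

Lemma val_exp v f k : f != 0 -> v (f ^+ k)%:F = k%:R * v f%:F.
Proof.
move=> f0; elim: k => [|k IH].
  rewrite expr0 mul0r tofrac1.
  have := vfunM v (oner_neq0 (ratfun R)) (oner_neq0 (ratfun R)).
  rewrite mulr1; lra.
rewrite exprS tofracM vfunM ?frac_neq0 ?expf_neq0// IH -natr1; ring.
Qed.

Definition degree_slopes v : set (\bar R) :=
  [set s | exists f d, [/\ f != 0, (0 < d)%N, deg_le d f & s = (v f%:F / d%:R)%:E]].

Lemma le_max_val v d f : f != 0 -> deg_le d f -> ((v f%:F)%:E <= max_val v d)%E.
Proof. by move=> f0 df; apply: ereal_sup_ubound; exists f. Qed.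

(** If f has degree at most d, its (n %/ d)-th power has degree at most n, and
    rounding n / d down costs at most v f / n after division by n.  So every
    slope v f / d is approached from below by the sequence defining mu_hat. *)
Lemma max_val_slope v f d n : f != 0 -> (0 < d)%N -> deg_le d f -> (0 < n)%N ->
  ((v f%:F / d%:R - v f%:F / n%:R)%:E <= (n%:R^-1)%:E * max_val v n)%E.
Proof.
move=> f0 d0 df n0.
have n0' : 0 < n%:R :> R by rewrite ltr0n.
have d0' : 0 < d%:R :> R by rewrite ltr0n.
have := @le_max_val v n (f ^+ (n %/ d)) (expf_neq0 _ f0)
  (@deg_le_leq _ _ _ (leq_trunc_div n d) (@deg_leX d f _ df)).
rewrite val_exp// => /(lee_wpmul2l (x := (n%:R^-1)%:E)).
rewrite lee_fin invr_ge0 (ltW n0') => /(_ isT); apply: le_trans.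
rewrite -EFinM lee_fin.
have vf := vfun_ge0 v f0.
have nd : n%:R <= ((n %/ d)%:R + 1) * d%:R :> R.
  by rewrite natr1 -natrM ler_nat ltnW// ltn_ceil.
rewrite -subr_ge0.
have -> : n%:R^-1 * ((n %/ d)%:R * v f%:F) - (v f%:F / d%:R - v f%:F / n%:R) =
    v f%:F * (((n %/ d)%:R + 1) * d%:R - n%:R) / (n%:R * d%:R).
  by field; rewrite !gt_eqF.
by rewrite divr_ge0 ?mulr_ge0 ?subr_ge0// ltW.
Qed.

(** The limit is a supremum, as for any superadditive sequence.  Each v f / d
    with f fixed is weakly continuous in v, and upper bounds on v f valid for
    all f pass to mu_hat: this is how both statements are reached. *)
Lemma mu_hatE v : mu_hat v = ereal_sup (degree_slopes v).
Proof.
apply: cvg_lim => //; apply: cvge_from_below.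
  near=> n.
  have n0 : (0 < n)%N by near: n; exact: nbhs_infty_gt.
  have n0' : 0 < n%:R :> R by rewrite ltr0n.
  rewrite muleC lee_pdivrMr//; apply: ge_ereal_sup => _ [f [f0 df] <-].
  rewrite -lee_pdivrMr// -EFinM; apply: ereal_sup_ubound.
  by exists f, n.
move=> a /ereal_sup_gt[_ [f [d [f0 d0 df ->]]] ad].
have lim0 : (v f%:F / d%:R - v f%:F / n%:R) @[n --> \oo] --> v f%:F / d%:R.
  rewrite -[X in _ --> X]subr0 -[X in _ --> _ - X](mulr0 (v f%:F)).
  apply: cvgB; first exact: cvg_cst.
  apply: cvgMl_tmp.
  apply/(@gtr0_cvgV0 R nat \oo _ (fun n => n%:R)); last exact: cvgr_idn.
  by near=> n; rewrite ltr0n; near: n; exact: nbhs_infty_gt.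
have : \forall n \near \oo, (a < (v f%:F / d%:R - v f%:F / n%:R)%:E)%E.
  have : nbhs (v f%:F / d%:R) [set r : R | (a < r%:E)%E].
    by apply: open_nbhs_nbhs; split=> //; exact: open_ereal_gt.
  by move=> /lim0.
move=> H; near=> n; apply: lt_le_trans (max_val_slope v f0 d0 df _).
  by near: n.
by near: n; exact: nbhs_infty_gt.
Unshelve. all: by end_near. Qed.

End Slope.

(** * Orders of f(x, xi + theta x^r) *)

Section Taylor.
Variable R : realType.
Implicit Types (f : bipoly R) (h k : thseries R) (xi : ratseries R) (r s : R).

Definition theta_free h := forall s, (size (h s) <= 1)%N.

Lemma theta_free0 : theta_free 0.
Proof. by move=> s; rewrite hcoef0 size_poly0. Qed.

Lemma theta_freeD h k : theta_free h -> theta_free k -> theta_free (h + k).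
Proof.
move=> fh fk s; rewrite hcoefD (leq_trans (size_polyD _ _))// geq_max.
by rewrite fh fk.
Qed.

Lemma theta_freeM h k : theta_free h -> theta_free k -> theta_free (h * k).
Proof.
move=> fh fk s; rewrite hcoefM /hconv.
elim/big_ind: _ => [|p q p1 q1|a _]; first by rewrite size_poly0.
  by rewrite (leq_trans (size_polyD _ _))// geq_max p1.
rewrite (size1_polyC (fh a)) (size1_polyC (fk (s - a))) -polyCM.
exact: size_polyC_leq1.
Qed.

Lemma theta_free_mono (c : R[i]) r : theta_free (hmono c%:P r).
Proof.
move=> s; rewrite hcoef_mono; case: ifP => _; last by rewrite size_poly0.
exact: size_polyC_leq1.
Qed.

Lemma theta_free_hseries xi : theta_free (hseries xi).
Proof. by move=> s; exact: size_polyC_leq1. Qed.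

Lemma theta_free_horner (K : nzRingType) (phi : {rmorphism K -> thseries R}) h
    (p : {poly K}) : (forall c, theta_free (phi c)) -> theta_free h ->
  theta_free (map_poly phi p).[h].
Proof.
move=> fphi fh; elim/poly_ind: p => [|p c IH].
  by rewrite rmorph0 horner0; exact: theta_free0.
rewrite rmorphD rmorphM /= map_polyX map_polyC hornerMXaddC.
by apply: theta_freeD; [exact: theta_freeM|exact: fphi].
Qed.

Lemma theta_free_subst xi f : theta_free (subst (hseries xi) f).
Proof.
apply: (@theta_free_horner {poly R[i]} (@evalx R)) => [p|]; last exact: theta_free_hseries.
apply: (@theta_free_horner R[i] (@hscalar R)) => [c|].
- exact: theta_free_mono.
- exact: theta_free_mono.
Qed.

Lemma hmonoX (c : {poly R[i]}) r n : hmono c r ^+ n = hmono (c ^+ n) (r *+ n).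
Proof.
elim: n => [|n IH]; first by rewrite !expr0 mulr0n.
by rewrite !exprS IH hmonoM mulrS.
Qed.

(** Taylor expansion of f(x, xi + theta x^r) in powers of theta x^r; the
    divided derivatives f^`N(j) are taken with respect to y. *)
Lemma subst_taylor xi r f :
  subst (qm_series xi r%:E) f =
    \sum_(j < size f) hmono 'X^j (r *+ j) * subst (hseries xi) f^`N(j).
Proof.
rewrite /subst /= /horner_eval /qm_series (@nderiv_taylor_wide _ (size f));
  [|exact: mulrC|exact: size_poly].
by apply: eq_bigr => j _; rewrite nderivn_map mulrC hmonoX.
Qed.

(** Since f^`N(j)(x, xi) is free of theta, distinct j contribute distinct powers
    of theta to the Taylor expansion, and no cancellation occurs between them. *)
Lemma coef_subst xi r f s j :
  (subst (qm_series xi r%:E) f s)`_j =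
    (subst (hseries xi) f^`N(j) (s - r *+ j))`_0.
Proof.
rewrite subst_taylor hcoef_sum coef_sum.
have E (k : nat) : ((hmono 'X^k (r *+ k) * subst (hseries xi) f^`N(k)) s)`_j =
   if k == j then (subst (hseries xi) f^`N(j) (s - r *+ j))`_0 else 0.
  rewrite hcoef_monoM (size1_polyC (@theta_free_subst xi f^`N(k) _)).
  rewrite coefMC coefXn eq_sym; case: eqP => [->|]; last by rewrite mul0r.
  by rewrite mul1r.
have [jf|jf] := ltnP j (size f).
  rewrite (bigD1 (Ordinal jf))//= E eqxx big1 ?addr0// => k kj.
  by rewrite E ifN//; apply: contraNneq kj => kj; exact/eqP/val_inj.
rewrite nderivn_poly0// rmorph0 hcoef0 coef0 big1// => k _.
by rewrite E ifN// ltn_eqF// (leq_trans (ltn_ord k)).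
Qed.

(** Together with hord_subst_eq below: the order of f(x, xi + theta x^r) is the
    minimum over j of c_j + r j, where c_j is the order of f^`N(j)(x, xi) and j
    ranges over the indices where this series is nonzero. *)
Lemma hord_subst_le xi r f j : subst (hseries xi) f^`N(j) != 0 ->
  hord (subst (qm_series xi r%:E) f) <= hord (subst (hseries xi) f^`N(j)) + r *+ j.
Proof.
move=> /hord_coef nz; apply: hord_le; apply: contraNneq nz => fs0.
apply/eqP; rewrite (size1_polyC (@theta_free_subst _ _ _)).
by rewrite -[X in subst _ _ X](addrK (r *+ j)) -coef_subst fs0 coef0.
Qed.

Lemma hord_subst_eq xi r f : f != 0 -> exists2 j,
  subst (hseries xi) f^`N(j) != 0 &
  hord (subst (qm_series xi r%:E) f) = hord (subst (hseries xi) f^`N(j)) + r *+ j.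
Proof.
move=> /(subst_fin_neq0 xi r) f0; have := hord_coef f0.
set s := hord _; set p := subst _ _ _ => p0.
(* any power of theta occurring in the lowest coefficient would do *)
pose j := (size p).-1.
have cj : (subst (hseries xi) f^`N(j) (s - r *+ j))`_0 != 0.
  by rewrite -coef_subst -/p -lead_coefE lead_coef_eq0.
have cj' : subst (hseries xi) f^`N(j) (s - r *+ j) != 0.
  by apply: contraNneq cj => ->; rewrite coef0.
have nz : subst (hseries xi) f^`N(j) != 0.
  by apply: contraNneq cj' => ->; rewrite hcoef0.
exists j => //; apply/eqP; rewrite eq_le hord_subst_le//=.
by have := hord_le cj'; lra.
Qed.

Lemma hord_subst_ge0 xi f : subst (hseries xi) f != 0 ->
  0 <= hord (subst (hseries xi) f).
Proof.
move=> f0; apply: hord_ge => // s; apply: near1_ge0; apply: near1_subst.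
by have := @qm_series_ge1 _ xi +oo%E (leey _); rewrite /qm_series addr0.
Qed.

Lemma hord_subst_mono xi r r' f : f != 0 -> r <= r' ->
  hord (subst (qm_series xi r%:E) f) <= hord (subst (qm_series xi r'%:E) f).
Proof.
move=> /(hord_subst_eq xi r')[j jn ->] rr'.
by apply: le_trans (hord_subst_le r jn) _; rewrite lerD2l lerMn2r rr' orbT.
Qed.

(** c + r' j <= (r' / r) (c + r j) as soon as c >= 0, and the orders c_j are
    nonnegative because xi has no term of negative exponent. *)
Lemma hord_subst_scale xi r r' f : f != 0 -> 0 < r -> r <= r' ->
  hord (subst (qm_series xi r'%:E) f) <=
    (r' / r) * hord (subst (qm_series xi r%:E) f).
Proof.
move=> /(hord_subst_eq xi r)[j jn ->] r0 rr'.
apply: le_trans (hord_subst_le r' jn) _; have := hord_subst_ge0 jn.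
move: (hord _) => c c0.
rewrite -[r' *+ j]mulr_natr -[r *+ j]mulr_natr.
have -> : r' / r * (c + r * j%:R) = r' / r * c + r' * j%:R.
  by field; rewrite gt_eqF.
by rewrite lerD2r ler_peMl// ler_pdivlMr// mul1r.
Qed.

Lemma hord_subst_le_series xi r f : subst (hseries xi) f != 0 ->
  hord (subst (qm_series xi r%:E) f) <= hord (subst (hseries xi) f).
Proof.
by move=> f0; have := @hord_subst_le xi r f 0; rewrite nderivn0 mulr0n addr0; apply.
Qed.

(** Once r exceeds c_0, the term j = 0 realizes the minimum of the c_j + r j, as
    the others are at least r. *)
Lemma hord_subst_stable xi r f : subst (hseries xi) f != 0 ->
  hord (subst (hseries xi) f) <= r ->
  hord (subst (qm_series xi r%:E) f) = hord (subst (hseries xi) f).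
Proof.
move=> f0 fr; apply/eqP; rewrite eq_le hord_subst_le_series//=.
have fn0 : f != 0 by apply: contraNneq f0 => ->; rewrite rmorph0.
have [[|j] jn ->] := hord_subst_eq xi r fn0; first by rewrite nderivn0 mulr0n addr0.
have := hord_subst_ge0 jn; have := hord_subst_ge0 f0; rewrite mulrS => c0 c1.
have := mulrn_wge0 j (le_trans c0 fr).
move: fr c0 c1; move: (hord _) (hord _) (r *+ j) => c c' d; lra.
Qed.

End Taylor.

(** * Lower semicontinuity for the weak topology *)

Section Weak.
Variable R : realType.
Implicit Types (f : bipoly R) (v w : valuation R).

Lemma mu_hat_ge0 v : (0 <= mu_hat v)%E.
Proof.
rewrite mu_hatE; apply: ereal_sup_ubound; exists 1, 1%N; split=> //; first exact: oner_neq0.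
  exact: deg_le1.
have /= := @val_exp R v 1 0 (oner_neq0 _); rewrite expr0 mul0r => ->.
by rewrite mul0r.
Qed.

Lemma le_mu_hat c v w : 0 < c ->
  (forall f, f != 0 -> w f%:F <= c * v f%:F) -> (mu_hat w <= c%:E * mu_hat v)%E.
Proof.
move=> c0 wv; rewrite !mu_hatE; apply: ge_ereal_sup => _ [f [d [f0 d0 df ->]]].
have d0' : 0 < d%:R :> R by rewrite ltr0n.
apply: (@le_trans _ _ (c%:E * (v f%:F / d%:R)%:E)%E).
  by rewrite -EFinM lee_fin mulrA ler_pM2r ?invr_gt0// wv.
apply: lee_wpmul2l; first by rewrite lee_fin ltW.
by apply: ereal_sup_ubound; exists f, d.
Qed.

Lemma weak_eval_continuous (q : ratfun R) : q != 0 ->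
  continuous (fun v : weak_val R => v q).
Proof.
move=> q0 v; pose i : {f : ratfun R | f != 0} := exist _ q q0.
have /cvg_sup/(_ i) H : nbhs v --> v by exact: cvg_id.
exact: cvg_trans (cvg_app _ H) (@initial_continuous _ _ (fun w : valuation R => w q) v).
Qed.

Lemma mu_hat_lower_semicontinuous :
  lower_semicontinuous (@mu_hat R : weak_val R -> \bar R).
Proof.
move=> v a; rewrite mu_hatE => /ereal_sup_gt[_ [f [d [f0 d0 df ->]]]].
rewrite lte_fin => ad.
exists [set w : weak_val R | a * d%:R < w f%:F]; last first.
  move=> w /= aw; rewrite mu_hatE.
  apply: (@lt_le_trans _ _ (w f%:F / d%:R)%:E).
    by rewrite lte_fin ltr_pdivlMr ?ltr0n.
  by apply: ereal_sup_ubound; exists f, d.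
rewrite ltr_pdivlMr ?ltr0n// in ad.
exact: (cvgr_gt _ (@weak_eval_continuous f%:F (frac_neq0 f0) v)).
Qed.

End Weak.

(** * Continuity for the strong topology *)

Section Strong.
Variables (R : realType) (xi : ratseries R) (b : bool).
Implicit Types (f : bipoly R) (s t : qm_dom xi).

Lemma qm_valE t f : f != 0 -> qm_val b t f%:F = qm_ord xi b (val t) f.
Proof.
by move=> f0; apply: frac_ext_poly f0; apply: qm_ordM; exact: set_mem (valP t).
Qed.

Let sw f := if b then swapXY f else f.

Let sw_neq0 f : f != 0 -> sw f != 0.
Proof. by rewrite /sw; case: b => //; rewrite swapXY_eq0. Qed.

Let val_cvg t : val s @[s --> t] --> val t.
Proof. exact: (@initial_continuous _ _ (@set_val _ (qm_dom xi)) t). Qed.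

Lemma mu_hat_qm_mono t t' : (val t <= val t')%E ->
  (mu_hat (qm_val b t) <= mu_hat (qm_val b t'))%E.
Proof.
move=> tt'; rewrite -[leRHS]mul1e; apply: le_mu_hat => // f f0.
rewrite mul1r (qm_valE t f0) (qm_valE t' f0) /qm_ord -/(sw f).
have nz' := qm_subst_neq0 b (set_mem (valP t')) f0.
move: tt' (set_mem (valP t)).1 nz'; rewrite -/(sw f).
case: (val t) => [r| |]; last by rewrite leeNy_eq.
  case: (val t') => [r'| |]; last by rewrite leeNy_eq.
    by rewrite lee_fin => rr' _ _; apply: hord_subst_mono => //; exact: sw_neq0.
  by rewrite /qm_series addr0 => _ _; exact: hord_subst_le_series.
by rewrite leye_eq => /eqP ->.
Qed.

Lemma mu_hat_qm_scale t t' r r' : val t = r%:E -> val t' = r'%:E -> r <= r' ->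
  (mu_hat (qm_val b t') <= (r' / r)%:E * mu_hat (qm_val b t))%E.
Proof.
move=> tr tr' rr'.
have := (set_mem (valP t)).1; rewrite tr lee_fin => r1.
have r0 : 0 < r by exact: lt_le_trans r1.
apply: le_mu_hat => [|f f0]; first by rewrite divr_gt0// (lt_le_trans r0).
rewrite (qm_valE t f0) (qm_valE t' f0) /qm_ord -/(sw f) tr tr'.
by apply: hord_subst_scale => //; exact: sw_neq0.
Qed.

(** Any a below mu_hat at +oo is already below the slope v f / d of a single
    polynomial f, and v(xi, t) takes on f the same value as v(xi, +oo) for all
    large t. *)
Lemma mu_hat_qm_cvgy t : val t = +oo%E ->
  mu_hat (qm_val b s) @[s --> t] --> mu_hat (qm_val b t).
Proof.
move=> ty; apply: (@cvge_from_below R _ (nbhs t)) => [|a].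
  by apply: nearW => s; apply: mu_hat_qm_mono; rewrite ty leey.
rewrite [mu_hat _]mu_hatE => /ereal_sup_gt[_ [f [d [f0 d0 df ->]]] ad].
have nz := qm_subst_neq0 b (set_mem (valP t)) f0.
move: nz; rewrite -/(sw f) ty /qm_series addr0 => nz.
have : \forall s \near t, ((hord (subst (hseries xi) (sw f)))%:E < val s)%E.
  apply: (@val_cvg t [set y | (_ < y)%E]); rewrite ty; apply: open_nbhs_nbhs.
  by split; [exact: open_ereal_gt_ereal|exact: ltry].
apply: filterS => s fs; apply: lt_le_trans ad _; rewrite mu_hatE.
apply: ereal_sup_ubound; exists f, d.
suff -> : qm_val b t f%:F = qm_val b s f%:F by split.
rewrite (qm_valE t f0) (qm_valE s f0) /qm_ord -/(sw f) ty.
move: (val s) fs => [r|_|]; last by rewrite ltNge leNye.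
  by rewrite lte_fin => /ltW /(hord_subst_stable nz) ->; rewrite /qm_series addr0.
by [].
Qed.

(** Writing r and p for the values of t and s, monotonicity and the scaling
    bound squeeze mu_hat at s between min(1, p / r) and max(1, p / r) times
    mu_hat at t. *)
Lemma mu_hat_qm_cvg t r : val t = r%:E ->
  mu_hat (qm_val b s) @[s --> t] --> mu_hat (qm_val b t).
Proof.
move=> tr.
have r0 : 0 < r.
  by have := (set_mem (valP t)).1; rewrite tr lee_fin; exact: lt_le_trans.
have cv : val s @[s --> t] --> r%:E by rewrite -tr.
have sfin : \forall s \near t, val s \is a fin_num := cvg_is_fine cv.
have {}cv : fine (val s) @[s --> t] --> r by exact: fine_cvg cv.
have lim (g : R -> R) : continuous g -> g r = 1 ->
    ((g (fine (val s)))%:E * mu_hat (qm_val b t))%E @[s --> t] -->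
      mu_hat (qm_val b t).
  move=> cg gr; rewrite -[X in _ --> X]mul1e.
  apply: (@cvgeM _ (nbhs t) _ _ (fun s => (g (fine (val s)))%:E)
    (cst (mu_hat (qm_val b t)))); last exact: cvg_cst.
    by case: (mu_hat _) => [x| |] //=.
  apply: cvg_EFin; first exact: nearW.
  by rewrite -gr; apply: (cvg_comp _ _ cv); exact: cg.
have rK : r / r = 1 by rewrite divff// gt_eqF.
have cdiv : continuous (fun p : R => p / r).
  by move=> p; apply: cvgMr_tmp; exact: cvg_id.
have cone : continuous (fun _ : R => 1 : R) by move=> p; exact: cvg_cst.
apply: (squeeze_cvge _
  (lim (fun p => Num.min 1 (p / r)) (min_fun_continuous cone cdiv) _)
  (lim (fun p => Num.max 1 (p / r)) (max_fun_continuous cone cdiv) _));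
  rewrite ?rK ?minxx ?maxxx//.
apply: filterS sfin => s sf.
have [p sp] : exists p, val s = p%:E by exists (fine (val s)); rewrite fineK.
have p0 : 0 < p.
  by have := (set_mem (valP s)).1; rewrite sp lee_fin; exact: lt_le_trans.
rewrite sp /=; have [rp|pr] := leP r p.
  have up := mu_hat_qm_scale tr sp rp.
  have lo : (mu_hat (qm_val b t) <= mu_hat (qm_val b s))%E.
    by apply: mu_hat_qm_mono; rewrite tr sp lee_fin.
  by rewrite min_l ?max_r ?ler_pdivlMr ?mul1r// mul1e; apply/andP.
have lo := mu_hat_qm_scale sp tr (ltW pr).
have up : (mu_hat (qm_val b s) <= mu_hat (qm_val b t))%E.
  by apply: mu_hat_qm_mono; rewrite tr sp lee_fin ltW.
have pr1 : p / r <= 1 by rewrite ler_pdivrMr// mul1r ltW.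
rewrite (min_r pr1) (max_l pr1) mul1e; apply/andP; split; last exact: up.
have pr0 : 0 < p / r by exact: divr_gt0.
by rewrite -(lee_pdivlMl _ _ pr0) invf_div; exact: lo.
Qed.

Lemma mu_hat_qm_continuous : continuous (fun t => mu_hat (qm_val b t)).
Proof.
move=> t; case E : (val t) => [r| |]; first exact: mu_hat_qm_cvg E.
  exact: mu_hat_qm_cvgy E.
by have := (set_mem (valP t)).1; rewrite E.
Qed.

End Strong.

(** The strong topology is final for the maps qm_val, so continuity is tested
    along each of them. *)
Lemma mu_hat_strong_continuous (R : realType) :
  continuous (@mu_hat R : strong_val R -> \bar R).
Proof.
apply/continuousP => A oA.
have sA : strong_open (@mu_hat R @^-1` A).
  by move=> xi b; have /continuousP := @mu_hat_qm_continuous R xi b; exact.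
exact: sA.
Qed.

Theorem theorem2p21 (R : realType) :
  lower_semicontinuous (@mu_hat R : weak_val R -> \bar R) /\
  continuous (@mu_hat R : strong_val R -> \bar R).
Proof.
split; first exact: mu_hat_lower_semicontinuous.
exact: mu_hat_strong_continuous.
Qed.
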